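(* Consider the Singleton Search Engine Game with the proportional selection rule. If $\beta>\frac{2K}{N+2K}$, there are instances with Price of Anarchy $\Omega(K)$. That is, there is an absolute constant $c>0$ such that for all $K\ge2$, all $N\ge K$, and all $\beta\in[0,1]$ with $\beta>\frac{2K}{N+2K}$, there is a distribution $\gamma$ on $N$ pages for which the game with $K$ engines and parameter $\beta$ has pure Price of Anarchy at least $cK$.
   Context: Proportional selection rule: $f_i(\mathbf q)=\frac{q_i}{\sum_j q_j}$ for $\mathbf q\in[0,1]^K\setminus\{\mathbf 0\}$, and $f_i(\mathbf 0)=1/K$. Singleton Search Engine Game: there are $K$ engines, $N$ pages $\{1,\dots,N\}$, and a probability distribution $\gamma$ on pages with $\gamma(n)>0$ for all $n$; a user of type $n$ (probability $\gamma(n)$) desires exactly page $n$ and looks only at the first displayed page. A pure strategy of engine $i$ is a probability vector $\mathbf q_i=(q_i(n))_{n=1}^N$, where $q_i(n)$ is the probability of displaying page $n$. With $\mathbf q(n)=(q_1(n),\dots,q_K(n))$ and parameter $\beta\in[0,1]$, engine $i$'s payoff is $\sum_n\gamma(n)f_i(\mathbf q(n))(\beta+(1-\beta)q_i(n))$, and the welfare is $W=\sum_n\gamma(n)\sum_i f_i(\mathbf q(n))q_i(n)$. A pure Nash equilibrium is a profile of pure strategies from which no engine can strictly improve her payoff by a unilateral deviation to another pure strategy. With $\mathrm{OPT}$ a welfare-maximizing strategy profile, the pure Price of Anarchy is the supremum of $W(\mathrm{OPT})/W(\mathbf{\mathcal D})$ over pure Nash equilibria $\mathbf{\mathcal D}$.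 *)

(* Defs.v *)
From mathcomp Require Import all_boot all_order all_algebra.
From mathcomp Require Import boolp classical_sets reals constructive_ereal ereal.

Set Implicit Arguments.
Unset Strict Implicit.
Unset Printing Implicit Defensive.

Import Order.TTheory GRing.Theory Num.Theory.
Local Open Scope classical_set_scope.
Local Open Scope ring_scope.

(* f q i is the probability that engine i is selected on quality vector q. *)
Definition selection_rule (R : realType) (K : nat) := ('I_K -> R) -> 'I_K -> R.

Definition proportional (R : realType) (K : nat) : selection_rule R K :=
  fun q i => if [forall j, q j == 0] then K%:R^-1 else q i / \sum_j q j.

Definition is_distribution (R : realType) (N : nat) (p : 'I_N -> R) : Prop :=
  (forall n, 0 <= p n) /\ \sum_n p n = 1.

Section SingletonGame.
Variables (R : realType) (K N : nat).
Variables (f : selection_rule R K) (gamma : 'I_N -> R) (beta : R).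

(* q i n is the probability that engine i displays page n. *)
Definition profile := 'I_K -> 'I_N -> R.
Implicit Types q : profile.

Definition is_profile q : Prop := forall i, is_distribution (q i).

Definition payoff q (i : 'I_K) : R :=
  \sum_n gamma n * f (q^~ n) i * (beta + (1 - beta) * q i n).

Definition welfare q : R :=
  \sum_n gamma n * \sum_i f (q^~ n) i * q i n.

Definition pure_nash q : Prop :=
  is_profile q /\
  forall (i : 'I_K) (p : 'I_N -> R), is_distribution p ->
    payoff [eta q with i |-> p] i <= payoff q i.

Definition optimal q : Prop :=
  is_profile q /\ forall q', is_profile q' -> welfare q' <= welfare q.

(* Extended-real supremum: it is -oo if there is no pure Nash equilibrium. *)
Definition pure_PoA : \bar R :=
  ereal_sup [set r | exists opt D : profile,
    [/\ optimal opt, pure_nash D & r = (welfare opt / welfare D)%:E]].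

End SingletonGame.

(* Main.v *)
Require Import Defs.
From mathcomp Require Import all_boot all_order all_algebra.
From mathcomp Require Import boolp classical_sets reals constructive_ereal ereal.
From mathcomp Require Import ring lra.

(** Take [gamma] uniform. Every welfare is at most [K / N], because a selection
    probability is at most 1, and [K / N] is reached when the engines display
    distinct pages. If every engine plays the uniform strategy, the welfare is
    only [1 / N], and this profile is a Nash equilibrium: against uniform
    opponents, showing a page with probability [p] earns, with
    [a = (K - 1) / N],
      [p (beta + (1 - beta) p) / (p + a)
         = (1 - beta) p + (beta - (1 - beta) a) p / (p + a)],
    which is concave in [p] as soon as [beta >= (K - 1) / (N + K - 1)], so the
    uniform strategy is a best reply. Hence the price of anarchy is at least [K]. *)

Set Implicit Arguments.
Unset Strict Implicit.
Unset Printing Implicit Defensive.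

Import Order.TTheory GRing.Theory Num.Theory.
Local Open Scope ring_scope.

Lemma proportional_le1 (R : realType) (K : nat) (q : 'I_K -> R) (i : 'I_K) :
  (forall j, 0 <= q j) -> proportional q i <= 1.
Proof.
move=> q_ge0; rewrite /proportional.
have K_gt0 : (0 < K)%N by apply: leq_ltn_trans (ltn_ord i).
case: ifPn => _; first by rewrite invf_le1 ?ltr0n ?ler1n.
have le_qi : q i <= \sum_j q j.
  by rewrite (bigD1 i) //= lerDl sumr_ge0.
(* A zero sum needs no contradiction: the quotient is then [0] by the convention for the inverse of
   [0]. *)
have [->|S_neq0] := eqVneq (\sum_j q j) 0; first by rewrite invr0 mulr0.
by rewrite ler_pdivrMr ?mul1r // lt_def S_neq0 sumr_ge0.
Qed.

Lemma proportional_neq0 (R : realType) (K : nat) (q : 'I_K -> R) (i j : 'I_K) :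
  q j != 0 -> proportional q i = q i / \sum_j q j.
Proof.
move=> qj_neq0; rewrite /proportional ifN //.
by apply/forallPn; exists j.
Qed.

Lemma proportional_const (R : realType) (K : nat) (x : R) (i : 'I_K) :
  proportional (fun=> x) i = K%:R^-1.
Proof.
have [->|x_neq0] := eqVneq x 0.
  by rewrite /proportional ifT //; apply/forallP => j.
rewrite (proportional_neq0 _ (j := i)) //= sumr_const card_ord -[x *+ K]mulr_natl.
by rewrite invfM mulrCA divff // mulr1.
Qed.

Section UniformPages.
Variables (R : realType) (K N : nat) (beta : R).
Hypotheses (K_gt1 : (1 < K)%N) (leKN : (K <= N)%N).

Let u : 'I_N -> R := fun=> N%:R^-1.
Let f := @proportional R K.

Let K_gt0 : 0 < K%:R :> R. Proof. by rewrite ltr0n ltnW. Qed.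
Let N_gt0 : 0 < N%:R :> R. Proof. by rewrite ltr0n (leq_trans _ leKN) // ltnW. Qed.

Lemma uniform_distribution : is_distribution u.
Proof.
split=> [n|]; first by rewrite invr_ge0 ltW.
by rewrite sumr_const card_ord -[_ *+ N]mulr_natl divff // lt0r_neq0.
Qed.

Lemma welfare_le (q : profile R K N) :
  is_profile q -> welfare f u q <= K%:R / N%:R.
Proof.
move=> q_prof.
(* The bound is the welfare with every selection probability replaced by 1: each strategy has total
   mass 1 and each page has weight [1 / N]. *)
have -> : K%:R / N%:R = \sum_n u n * \sum_i q i n.
  rewrite -big_distrr /= exchange_big /= mulrC.
  under [in RHS]eq_bigr => i _ do rewrite (q_prof i).2.
  by rewrite sumr_const card_ord.
apply: ler_sum => n _; apply: ler_wpM2l; first by rewrite invr_ge0 ltW.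
apply: ler_sum => i _; apply: ler_piMl; first exact: (q_prof i).1.
by apply: proportional_le1 => j; apply: (q_prof j).1.
Qed.

Let spread : profile R K N := fun i n => (n == widen_ord leKN i)%:R.

Lemma spread_is_profile : is_profile spread.
Proof.
move=> i; split=> [n|]; first exact: ler0n.
rewrite (bigD1 (widen_ord leKN i)) //= /spread eqxx big1 ?addr0 // => n.
by move/negPf->.
Qed.

Lemma welfare_spread : welfare f u spread = K%:R / N%:R.
Proof.
(* No two engines display the same page, so an engine that displays page [n] is selected on it with
   probability 1. *)
have fq n i : f (spread^~ n) i * spread i n = spread i n.
  have [->|qi_neq0] := eqVneq (spread i n) 0; first by rewrite mulr0.
  rewrite /f (proportional_neq0 _ (j := i)) //.
  have nE : n = widen_ord leKN i.
    by apply: contraNeq qi_neq0 => /negPf; rewrite /spread => ->.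
  rewrite (bigD1 i) //= big1 ?addr0 => [|j neq_ji]; first by rewrite divfK.
  rewrite /spread nE -val_eqE /= eq_sym.
  by rewrite (inj_eq val_inj) (negPf neq_ji).
rewrite /welfare.
under eq_bigr => n _ do under eq_bigr => i _ do rewrite fq.
rewrite -big_distrr /= exchange_big /= mulrC.
under eq_bigr => i _ do rewrite (spread_is_profile i).2.
by rewrite sumr_const card_ord.
Qed.

Lemma spread_optimal : optimal f u spread.
Proof.
split=> [|q q_prof]; first exact: spread_is_profile.
by rewrite welfare_spread welfare_le.
Qed.

Let uniform : profile R K N := fun=> u.

Lemma welfare_uniform : welfare f u uniform = N%:R^-1.
Proof.
rewrite /welfare.
rewrite (eq_bigr (fun n => u n * N%:R^-1)) => [|n _].
  by rewrite -big_distrl /= uniform_distribution.2 mul1r.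
congr (_ * _); rewrite (eq_bigr (fun=> K%:R^-1 * N%:R^-1)) => [|i _].
  rewrite sumr_const card_ord -[_ *+ K]mulr_natl mulrA.
  by rewrite divff ?lt0r_neq0 // mul1r.
by rewrite /f proportional_const.
Qed.

(** Total probability put on a given page by [K - 1] uniform opponents ([a]) and by all [K] engines
    under [uniform] ([s]). *)
Let a : R := (K%:R - 1) / N%:R.
Let s : R := K%:R / N%:R.

(** Since [K > 1], some opponent still puts [1 / N > 0] on page [n], so the zero-vector branch of
    the rule never applies, even when [p n = 0]. *)
Lemma proportional_deviation (p : 'I_N -> R) (i : 'I_K) n :
  f ([eta uniform with i |-> p]^~ n) i = p n / (p n + a).
Proof.
have [j neq_ji] : exists j : 'I_K, j != i.
  apply/existsP; rewrite -negb_forall; apply/negP => /forallP all_i.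
  have := all_i (Ordinal K_gt1); have := all_i (Ordinal (ltnW K_gt1)).
  by move=> /eqP <- /eqP[].
rewrite /f (proportional_neq0 _ (j := j)) /=; last first.
  by rewrite (negPf neq_ji) invr_neq0 // lt0r_neq0.
rewrite eqxx (bigD1 i) //= eqxx; congr (_ / (_ + _)).
rewrite (eq_bigr (fun=> N%:R^-1)) => [|k /negPf->//].
rewrite sumr_const cardC1 card_ord -[_ *+ K.-1]mulr_natl -subn1.
by rewrite natrB ?(ltnW K_gt1).
Qed.

(* The right-hand side is the tangent of the concave left-hand side at
   [x = 1 / N], where [x + a = s]. *)
Lemma page_payoff_le (x : R) :
  (1 - beta) * a <= beta -> 0 <= x ->
  x / (x + a) * (beta + (1 - beta) * x) <=
  K%:R^-1 * (beta + (1 - beta) / N%:R)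
    + ((1 - beta) + (beta - (1 - beta) * a) * (a / s ^+ 2)) * (x - N%:R^-1).
Proof.
move=> beta_ge x_ge0.
have a_gt0 : 0 < a by rewrite divr_gt0 // subr_gt0 ltr1n.
have s_gt0 : 0 < s by rewrite divr_gt0.
have y_gt0 : 0 < x + a by apply: ltr_wpDl.
rewrite -subr_ge0.
set lhs := (X in 0 <= X).
(* The gap between tangent and function is a square, as [x + a - s = x - 1 / N], times a factor
   whose sign is given by [beta_ge]. *)
have -> : lhs = (beta - (1 - beta) * a) * a * (x + a - s) ^+ 2
                  / (s ^+ 2 * (x + a)).
  move: (lt0r_neq0 y_gt0); rewrite /lhs /s /a => y_neq0.
  field; rewrite !lt0r_neq0 //=.
  (* The side condition left by [field] concerns [x + a] multiplied through by [N]. *)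
  move: y_gt0; rewrite /a -(pmulr_rgt0 _ N_gt0) => h; move: h.
  by congr (_ < _); field; rewrite lt0r_neq0.
apply: divr_ge0; last by rewrite ltW // mulr_gt0 // exprn_gt0.
by rewrite mulr_ge0 ?sqr_ge0 // mulr_ge0 ?subr_ge0 // ltW.
Qed.

(** The tangent has the same slope on every page, and the deviations [p n - 1 / N] sum to 0, so the
    linear terms cancel in the sum over pages. *)
Lemma uniform_nash : (1 - beta) * a <= beta -> pure_nash f u beta uniform.
Proof.
move=> beta_ge; split=> [i|i p [p_ge0 p_sum]]; first exact: uniform_distribution.
rewrite /payoff.
under eq_bigr => n _ do rewrite proportional_deviation /= eqxx -mulrA.
under [leRHS]eq_bigr => n _ do rewrite /f proportional_const -mulrA.
rewrite -!big_distrr /=; apply: ler_wpM2l; first by rewrite invr_ge0 ltW.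
apply: le_trans (ler_sum _ (fun n _ => page_payoff_le beta_ge (p_ge0 n))) _.
rewrite big_split /= -[X in _ + X]big_distrr /= sumrB p_sum.
by rewrite uniform_distribution.2 subrr mulr0 addr0 big_distrr.
Qed.

Lemma pure_PoA_uniform_ge :
  (1 - beta) * a <= beta -> ((K%:R)%:E <= pure_PoA f u beta)%E.
Proof.
move=> beta_ge; apply: ereal_sup_ubound; exists spread, uniform; split.
- exact: spread_optimal.
- exact: uniform_nash.
- by rewrite welfare_spread welfare_uniform invrK divfK // lt0r_neq0.
Qed.

End UniformPages.

Theorem proposition5p2 (R : realType) :
  exists c : R, 0 < c /\
    forall (K N : nat) (beta : R),
      (2 <= K)%N -> (K <= N)%N ->
      0 <= beta <= 1 ->
      2 * K%:R / (N%:R + 2 * K%:R) < beta ->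
      exists gamma : 'I_N -> R,
        [/\ is_distribution gamma, (forall n, 0 < gamma n) &
            ((c * K%:R)%:E <= pure_PoA (@proportional R K) gamma beta)%E].
Proof.
exists 1; split=> // K N beta K_gt1 leKN /andP[_ beta_le1] beta_gt.
have N_gt0 : 0 < N%:R :> R by rewrite ltr0n (leq_trans _ leKN) // ltnW.
have K_ge0 : 0 <= K%:R :> R by rewrite ler0n.
exists (fun=> N%:R^-1); split; first exact: (uniform_distribution R K_gt1 leKN).
  by move=> n; rewrite invr_gt0.
rewrite mul1r; apply: pure_PoA_uniform_ge => //.
(* The hypothesis rearranges to [beta * N > 2 * K * (1 - beta)], which is at least
   [(K - 1) * (1 - beta)] because [beta <= 1]. *)
move: beta_gt; rewrite mulrA ler_pdivrMr // ltr_pdivrMr; last lra.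
nra.
Qed.
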